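(* Let $G=(V,w,m,d)$ be a graph with non-negative Ollivier curvature. If $\inf_{x\in V}m(x)>0$, then the number of ends of $G$ is at most two (i.e. $G$ does not have at least three ends).
   Context: A graph $G=(V,w,m,d)$ consists of a countable set $V$, a symmetric function $w:V\times V\to[0,\infty)$ vanishing on the diagonal, a function $m:V\to(0,\infty)$, and a metric $d:V\times V\to[0,\infty)$. Write $x\sim y$ if $w(x,y)>0$. The graph is locally finite (every vertex has finitely many neighbours), $d$ is a path metric, i.e. $d(x,y)=\inf\{\sum_{i=1}^n d(x_{i-1},x_i): x=x_0\sim\dots\sim x_n=y\}$ (since $d$ is finite-valued, $G$ is connected), and all balls of $d$ are finite. Laplacian: $\Delta f(x)=\frac1{m(x)}\sum_y w(x,y)(f(y)-f(x))$. $Lip(1)=\{f\in\mathbb{R}^V: f(y)-f(x)\le d(x,y)\ \forall x,y\in V\}$. Ollivier curvature for $x\ne y$: $\kappa(x,y)=\frac1{d(x,y)}\inf\{\Delta f(x)-\Delta f(y): f\in Lip(1),\ f(y)-f(x)=d(x,y)\}$. $G$ has non-negative Ollivier curvature if $\kappa(x,y)\ge0$ for all $x\sim y$. Ends: $G$ has at least $n$ ends if there is a finite $K\subset V$ such that $V\setminus K$ has at least $n$ infinite connected components (of the induced subgraph). *)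

(* Defs.v *)
From HB Require Import structures.
From mathcomp Require Import all_boot all_order all_algebra.
From mathcomp Require Import all_classical all_reals all_analysis.

Set Implicit Arguments.
Unset Strict Implicit.
Unset Printing Implicit Defensive.

Import Order.TTheory GRing.Theory Num.Theory.

Local Open Scope classical_set_scope.
Local Open Scope ring_scope.

(* In [dist_path_metric] a walk x = x_0 ~ ... ~ x_n = y is given by x and the
   sequence p = [:: x_1; ...; x_n]; n = 0 is allowed. The infimum is taken in
   the extended reals, where the infimum of the empty set is +oo, so this field
   forces the graph to be connected. *)
Record metric_graph (R : realType) := MetricGraph {
  vertex :> countType;
  weight : vertex -> vertex -> R;
  mass : vertex -> R;
  dist : vertex -> vertex -> R;
  weight_ge0 : forall x y, 0 <= weight x y;
  weight_sym : forall x y, weight x y = weight y x;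
  weight_diag : forall x, weight x x = 0;
  mass_gt0 : forall x, 0 < mass x;
  dist_ge0 : forall x y, 0 <= dist x y;
  dist_eq0 : forall x y, dist x y = 0 <-> x = y;
  dist_sym : forall x y, dist x y = dist y x;
  dist_triangle : forall x y z, dist x z <= dist x y + dist y z;
  locally_finite : forall x, finite_set [set y | 0 < weight x y];
  dist_path_metric : forall x y, (dist x y)%:E =
    ereal_inf [set (\sum_(l <- pairmap dist x p) l)%:E | p in
      [set p : seq vertex |
        path (fun u v => 0 < weight u v) x p /\ last x p = y]];
  finite_balls : forall x r, finite_set [set y | dist x y <= r] }.

Section MetricGraph.
Variables (R : realType) (G : metric_graph R).

Definition adj : rel G := fun x y => 0 < weight x y.

(* [\sum_(y \in A)] sums over the support of the summand, which is finite here
   by local finiteness. *)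
Definition laplacian (f : G -> R) (x : G) : R :=
  (mass x)^-1 * \sum_(y \in [set: G]) (weight x y * (f y - f x)).

Definition Lip1 : set (G -> R) :=
  [set f | forall x y, f y - f x <= dist x y].

Definition ollivier_curvature (x y : G) : \bar R :=
  ((dist x y)^-1%:E *
   ereal_inf [set (laplacian f x - laplacian f y)%:E | f in
     [set f | Lip1 f /\ (f y - f x = dist x y)%R]])%E.

Definition nonneg_ollivier_curvature : Prop :=
  forall x y, adj x y -> (0 <= ollivier_curvature x y)%E.

(* Connected component of x in the subgraph induced on S, for x in S. *)
Definition component_of (S : set G) (x : G) : set G :=
  [set y | exists p : seq G,
    [/\ path adj x p, last x p = y & forall z, z \in x :: p -> S z]].

Definition is_component (S C : set G) : Prop :=
  exists2 x, S x & C = component_of S x.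

Definition has_at_least_ends (n : nat) : Prop :=
  exists2 K : set G, finite_set K &
    exists C : 'I_n -> set G,
      injective C /\
      forall i, is_component (~` K) (C i) /\ infinite_set (C i).

End MetricGraph.

(* Main.v *)
Require Import Defs.
From HB Require Import structures.
From mathcomp Require Import all_boot all_order all_algebra.
From mathcomp Require Import all_classical all_reals all_analysis.
From mathcomp Require Import ring lra.

Set Implicit Arguments.
Unset Strict Implicit.
Unset Printing Implicit Defensive.

Import Order.TTheory GRing.Theory Num.Theory.

Local Open Scope classical_set_scope.
Local Open Scope ring_scope.

(* Let X, Y, Z be three ends off a large ball B. A 1-Lipschitz function f on B is
   extended by the minimum of f(k) + d(x,k) off Y and by the maximum of
   f(k) - d(x,k) on Y. Non-negative curvature says that the Laplacian decreases
   along pairs with f(y) - f(x) = d(x,y). A minimiser f of the maximum of the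
   Laplacian on B has nonpositive Laplacian on B: otherwise the Laplacian would
   be bounded below by a positive constant on B, hence on Y, which a flux
   estimate forbids because Y has infinite mass. So f is superharmonic off Y.
   Call x good if f(y) - f(x) = d(x,y) for infinitely many y in X. Some point of
   B is good; the flux estimate on X gives zero Laplacian at good points, and
   this rigidity makes neighbours of good points outside Y good, so all points
   outside Y are good. At a good point z of Z, a geodesic to X meets B, so f(z)
   is at most the maximum of f on B; but f is proper on Z. *)

(** * Maxima over finite sequences *)

Section SeqMax.
Variables (R : realDomainType) (T : eqType).
Implicit Types (a : T) (s : seq T) (F : T -> R).

(** The seed [F a] gives the empty sequence a value; for [a] in [s] the result is the true
    maximum. *)
Definition seqmax a s F : R := \big[Num.max/F a]_(k <- s) F k.

Lemma seqmax_ge a s F k : k \in s -> F k <= seqmax a s F.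
Proof. by move=> ks; rewrite /seqmax le_bigmax_seq. Qed.

Lemma seqmax_attained a s F : a \in s -> exists2 k, k \in s & seqmax a s F = F k.
Proof.
move=> a_s; suff: forall t, {subset t <= s} ->
    exists2 k, k \in s & seqmax a t F = F k by apply.
elim=> [|b t IH] ts; first by exists a; rewrite // /seqmax big_nil.
have [k ks Ek] : exists2 k, k \in s & seqmax a t F = F k.
  by apply: IH => z zt; apply: ts; rewrite inE zt orbT.
rewrite /seqmax big_cons -/(seqmax a t F) Ek; case: (leP (F b) (F k)) => _.
  by exists k.
by exists b; rewrite // ts ?mem_head.
Qed.

End SeqMax.

Lemma count_lt (T : eqType) (a b : pred T) (s : seq T) :
  {in s, forall x, a x -> b x} -> (exists2 x, x \in s & b x && ~~ a x) ->
  (count a s < count b s)%N.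
Proof.
move=> ab [x xs /andP[bx ax]].
have -> : count b s = (count a s + count (predD b a) s)%N.
  rewrite -count_predUI -[LHS]addn0; congr (_ + _)%N.
    apply: eq_in_count => z zs /=.
    by case: (boolP (a z)) => //= /(ab _ zs) ->.
  apply/esym/eqP; rewrite -leqn0 leqNgt -has_count; apply/hasPn => z _ /=.
  by case: (a z).
by rewrite -addn1 leq_add2l -has_count; apply/hasP; exists x; rewrite //= ax.
Qed.

(** * Compactness and the existence of minimisers *)

Section ArgMin.
Import numFieldNormedType.Exports ArrowAsProduct.

(** By Tychonoff the box is compact in the product topology, and the constraints by [D] cut out a
    closed subset. The estimate on [F] involves only the finitely many coordinates in [s], which
    makes [F] continuous. *)
Lemma box_argmin (R : realType) (T : eqType) (c : T -> R) (D : T -> T -> R)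
   (s : seq T) (F : (T -> R) -> R) (L : R) :
  (forall f g (e : R), 0 < e -> {in s, forall k, `|f k - g k| <= e} ->
     F f <= F g + L * e) ->
  (exists2 f : T -> R, (forall x, `|f x| <= c x) & (forall x y, f y - f x <= D x y)) ->
  exists2 f : T -> R, (forall x y, f y - f x <= D x y) &
    forall g : T -> R, (forall x, `|g x| <= c x) ->
      (forall x y, g y - g x <= D x y) -> F f <= F g.
Proof.
move=> FL [f0 f0c f0D].
pose K (_ : T) : topologicalType := R.
pose X : topologicalType := forall x, K x.
have projC i : continuous (fun f : X => f i).
  exact: (@proj_continuous T K i).
have box_compact := @tychonoff T K (fun i => `[- c i, c i]%classic)
  (fun i => @segment_compact _ _ _).
have D_closed : closed (\bigcap_(p in [set: T * T])
    [set f : X | (f p.2 : R) - f p.1 <= D p.1 p.2]).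
  apply: closed_bigI => -[x y] _.
  apply: (@closed_comp X R (fun f => (f y : R) - f x) [set t | t <= D x y]);
    last exact: closed_le.
  move=> f _; apply: (@continuousB R R^o); exact: projC.
have F_cont : continuous (F : X -> R).
  move=> f; apply/(@cvgrPdist_le R R^o _ _ (@nbhs_filter X f) F (F f)) => e e0.
  pose L1 := `|L| + 1.
  have L1_gt0 : 0 < L1 by rewrite ltr_wpDl.
  have d0 : 0 < e / L1 by rewrite divr_gt0.
  have nb : \forall g \near f, {in s, forall k, `|f k - g k : R| <= e / L1}.
    elim: s {FL} => [|k s IH]; first by near=> g => k.
    near=> g => u; rewrite inE => /orP[/eqP ->|].
      near: g; have := projC k f.
      by move=> /(@cvgrPdist_le _ R^o); apply.
    by move: u; near: g.
  near=> g; have nbg : {in s, forall k, `|f k - g k : R| <= e / L1} by near: g.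
  have le_e : L * (e / L1) <= e.
    rewrite mulrA ler_pdivrMr// mulrC ler_pM2l//.
    by rewrite (le_trans (ler_norm L))// lerDl.
  have := FL _ _ _ d0 nbg.
  have := FL g f _ d0; rewrite ler_norml => H1 H2.
  have {}H1 : F g <= F f + L * (e / L1).
    by apply: H1 => k /nbg; rewrite distrC.
  by apply/andP; split; lra.
have [|f Af fmin] := compact_EVT_min _
    (compact_closedI box_compact D_closed) (continuous_subspaceT F_cont).
  exists f0; split => [i|[x y] _] /=; last exact: f0D.
  by rewrite in_itv/= -ler_norml.
move: Af; rewrite inE => -[_ fD]; exists f => [x y|g gc gD]; first exact: (fD (x, y)).
apply: fmin; rewrite inE; split=> [i|[x y] _] /=; last exact: gD.
by rewrite in_itv/= -ler_norml.
Unshelve. all: by end_near. Qed.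

End ArgMin.

Lemma infinite_set_big (T : eqType) (A : set T) (s : seq T) :
  infinite_set A -> exists2 x, A x & x \notin s.
Proof.
move=> Ainf; apply: contrapT => nex; apply: Ainf.
apply: (@sub_finite_set _ _ [set` s]); last by apply/finite_seqP; exists s.
by move=> x Ax /=; apply/negPn/negP => xs; apply: nex; exists x.
Qed.

Lemma finite_set_cover (T : Type) (U : eqType) (s : seq U) (P : U -> set T)
    (A : set T) :
  (forall x, A x -> exists2 k, k \in s & P k x) ->
  (forall k, k \in s -> finite_set (P k)) -> finite_set A.
Proof.
move=> cov Pfin; apply: (@sub_finite_set _ _ (\bigcup_(k in [set` s]) P k)).
  by move=> x /cov[k ks Px]; exists k.
by apply: bigcup_finite => //; apply/finite_seqP; exists s.
Qed.

(** * The Laplacian on metric graphs and its comparison principles *)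

Section MetricGraphTheory.
Variables (R : realType) (G : metric_graph R).
Implicit Types (x y z : G) (f g : G -> R) (s : seq G).

Lemma dist_xx x : dist x x = 0. Proof. exact/dist_eq0. Qed.

Lemma dist_gt0 x y : x <> y -> 0 < dist x y.
Proof.
move=> xy; rewrite lt_neqAle dist_ge0 andbT eq_sym.
by apply/eqP => /dist_eq0.
Qed.

Lemma adj_sym x y : adj x y = adj y x.
Proof. by rewrite /adj weight_sym. Qed.

Lemma adj_neq x y : adj x y -> x <> y.
Proof. by move=> + xy; rewrite xy /adj weight_diag ltxx. Qed.

Lemma weight_adj0 x y : ~~ adj x y -> weight x y = 0.
Proof. by rewrite /adj -leNgt => xy; apply/le_anti; rewrite xy weight_ge0. Qed.

Lemma seq_of_finite_set (A : set G) :
  finite_set A -> exists s, uniq s /\ forall x, x \in s <-> A x.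
Proof.
move=> /finite_seqP[s ->]; exists (undup s); split; first exact: undup_uniq.
by move=> x; rewrite mem_undup.
Qed.

Definition nbrs x : seq G := sval (cid (seq_of_finite_set (locally_finite x))).

Lemma nbrs_uniq x : uniq (nbrs x).
Proof. by rewrite /nbrs; case: cid => s []. Qed.

Lemma mem_nbrs x y : (y \in nbrs x) = adj x y.
Proof. by rewrite /nbrs; case: cid => s [_ sE] /=; apply/idP/idP => /sE. Qed.

Definition ball_seq x r : seq G := sval (cid (seq_of_finite_set (finite_balls x r))).

Lemma mem_ball_seq x r y : (y \in ball_seq x r) = (dist x y <= r).
Proof. by rewrite /ball_seq; case: cid => s [_ sE] /=; apply/idP/idP => /sE. Qed.

Lemma sum_weight f x s : uniq s -> {subset nbrs x <= s} ->
  \sum_(y \in [set: G]) (weight x y * (f y - f x)) =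
  \sum_(y <- s) weight x y * (f y - f x).
Proof.
move=> us ns; rewrite (@fsbig_seq _ _ _ _ s _ us); apply/esym/fsbig_widen => //.
move=> y [_ /= ys].
by rewrite weight_adj0 ?mul0r// -mem_nbrs; apply/negP => /ns.
Qed.

Lemma laplacianE f x s : uniq s -> {subset nbrs x <= s} ->
  laplacian f x = (mass x)^-1 * \sum_(y <- s) weight x y * (f y - f x).
Proof. by move=> us ns; rewrite /laplacian (sum_weight f us ns). Qed.

Lemma laplacian_nbrs f x :
  laplacian f x = (mass x)^-1 * \sum_(y <- nbrs x) weight x y * (f y - f x).
Proof. by apply: laplacianE => //; exact: nbrs_uniq. Qed.

Lemma laplacianN f x : laplacian (fun z => - f z) x = - laplacian f x.
Proof.
rewrite !laplacian_nbrs -mulrN -sumrN; congr (_ * _).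
by apply: eq_bigr => y _; rewrite -mulrN opprB opprK addrC.
Qed.

(** The total jump rate at [x] of the random walk generated by the Laplacian. *)
Definition deg x : R := (mass x)^-1 * \sum_(y <- nbrs x) weight x y.

Lemma deg_ge0 x : 0 <= deg x.
Proof.
rewrite mulr_ge0 ?invr_ge0 ?(ltW (mass_gt0 x))//.
by apply: sumr_ge0 => y _; exact: weight_ge0.
Qed.

Lemma laplacian_le f g x e :
  (forall y, adj x y -> f y <= g y + e) ->
  laplacian f x <= laplacian g x + deg x * (g x + e - f x).
Proof.
move=> fg; rewrite !laplacian_nbrs /deg -mulrA -mulrDr ler_pM2l ?invr_gt0 ?mass_gt0//.
rewrite mulr_suml -big_split /= big_seq_cond [leRHS]big_seq_cond.
apply: ler_sum => y; rewrite andbT mem_nbrs => xy; rewrite -mulrDr.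
rewrite ler_wpM2l ?weight_ge0//; move: (fg _ xy); lra.
Qed.

Lemma laplacian_lt f g x z : adj x z -> f z < g z -> f x = g x ->
  (forall y, adj x y -> f y <= g y) -> laplacian f x < laplacian g x.
Proof.
move=> xz fz fx fg; rewrite !laplacian_nbrs ltr_pM2l ?invr_gt0 ?mass_gt0//.
have zn : z \in nbrs x by rewrite mem_nbrs.
rewrite !(big_rem z zn) /= ltr_leD//.
  by rewrite ltr_pM2l// fx ltrD2r.
rewrite big_seq_cond [leRHS]big_seq_cond; apply: ler_sum => y.
rewrite andbT => /mem_rem; rewrite mem_nbrs => xy.
by rewrite ler_wpM2l ?weight_ge0// fx lerD2r fg.
Qed.

(** * Geodesics *)

Lemma dist_le_walk x p :
  dist x (last x p) <= \sum_(l <- pairmap (@dist R G) x p) l.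
Proof.
elim: p x => [|z p IH] x /=; first by rewrite big_nil dist_xx.
rewrite big_cons; apply: le_trans (dist_triangle x z _) _.
by rewrite lerD2l.
Qed.

(** There are finitely many first steps. If all of them were wasteful, the least excess would keep
    every walk from [x] to [y] longer than [dist x y] by a fixed amount, against the path metric. *)
Lemma geodesic_step x y : x <> y ->
  exists2 z, adj x z & dist x y = dist x z + dist z y.
Proof.
move=> xy; apply: contrapT => nex.
have lt_step z : adj x z -> dist x y < dist x z + dist z y.
  move=> xz; rewrite lt_neqAle dist_triangle andbT; apply/eqP => E.
  by apply: nex; exists z.
have [c cgt cle] : exists2 c, dist x y < c &
    forall z, adj x z -> c <= dist x z + dist z y.
  (* Without neighbours there is no constraint, and any number above [dist x y] serves as [c]. *)
  have [E|] := eqVneq (nbrs x) [::].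
    by exists (dist x y + 1) => [|z]; [lra|rewrite -mem_nbrs E].
  case En : (nbrs x) => [//|a s] _.
  have aN : a \in nbrs x by rewrite En mem_head.
  have [k kN Ek] := seqmax_attained (fun z => - (dist x z + dist z y)) aN.
  exists (dist x k + dist k y); first by rewrite lt_step// -mem_nbrs.
  move=> z; rewrite -mem_nbrs => /(@seqmax_ge _ _ a _ (fun z => - (dist x z + dist z y))).
  by rewrite Ek lerN2.
have : (c%:E <= (dist x y)%:E)%E.
  rewrite dist_path_metric; apply/ereal_infP => _ [p pE <-].
  case: p pE => [[_ E]|z p /= [/andP[xz _] pl]]; first by case: xy.
  rewrite big_cons lee_fin; apply: le_trans (cle _ xz) _.
  by rewrite lerD2l -pl dist_le_walk.
by rewrite lee_fin leNgt cgt.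
Qed.

(** Distances are real, but balls are finite, so descent towards [y] terminates: the induction runs
    on the number of points of a fixed ball strictly closer to [y]. *)
Lemma dist_ind y (P : G -> Prop) :
  (forall x, (forall z, dist z y < dist x y -> P z) -> P x) -> forall x, P x.
Proof.
move=> step x.
pose s := ball_seq y (dist x y).
pose n z := count (fun u => dist u y < dist z y) s.
suff: forall k z, (n z < k)%N -> dist z y <= dist x y -> P z.
  by move=> /(_ (n x).+1 x); apply.
elim=> // k IH z nk zx; apply: step => u uz.
have us : u \in s by rewrite mem_ball_seq dist_sym (le_trans (ltW uz)).
apply: IH; last exact: le_trans (ltW uz) zx.
rewrite -ltnS; apply: leq_ltn_trans nk.
apply: count_lt => [v _ vu|]; first exact: lt_trans uz.
by exists u; rewrite //= uz ltxx.
Qed.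

(** * Lipschitz functions and their extension from finite sets *)

Lemma Lip1N f : Lip1 f -> Lip1 (fun z => - f z).
Proof. by move=> fL x y; rewrite opprK addrC dist_sym; exact: fL. Qed.

Lemma Lip1_geodesic f x y z : Lip1 f -> dist x y = dist x z + dist z y ->
  f y - f x = dist x y -> f z - f x = dist x z /\ f y - f z = dist z y.
Proof. by move=> fL; move: (fL x z) (fL z y); split; lra. Qed.

(* The least 1-Lipschitz function above [f] on [a :: s]; in use [a] is in [s]. *)
Definition lower_ext (a : G) s f : G -> R :=
  fun z => seqmax a s (fun k => f k - dist z k).

Lemma lower_ext_ge a s f z k : k \in s -> f k - dist z k <= lower_ext a s f z.
Proof. exact: (@seqmax_ge _ _ a s (fun k => f k - dist z k)). Qed.

Lemma lower_ext_attained a s f z : a \in s ->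
  exists2 k, k \in s & lower_ext a s f z = f k - dist z k.
Proof. exact: seqmax_attained. Qed.

Lemma lower_ext_Lip1 a s f : a \in s -> Lip1 (lower_ext a s f).
Proof.
move=> a_s x y; have [k ks ->] := lower_ext_attained f y a_s.
move: (lower_ext_ge a f x ks) (dist_triangle x y k); lra.
Qed.

Lemma lower_ext_id a s f k : a \in s ->
  {in s &, forall u v, f v - f u <= dist u v} -> k \in s ->
  lower_ext a s f k = f k.
Proof.
move=> a_s fL ks; apply/le_anti/andP; split; last first.
  by have := lower_ext_ge a f k ks; rewrite dist_xx subr0.
have [v vs ->] := lower_ext_attained f k a_s.
by move: (fL _ _ ks vs); lra.
Qed.

Lemma lower_ext_le a s f z : a \in s -> Lip1 f -> lower_ext a s f z <= f z.
Proof.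
move=> a_s fL; have [k _ ->] := lower_ext_attained f z a_s.
move: (fL z k); lra.
Qed.

(** * Regions closed under adjacency off [B]: crossing and flux *)

Section Separation.
Variables (W : set G) (B : seq G).
Hypothesis W_B : forall x, W x -> x \notin B.
Hypothesis W_adj : forall x y, W x -> adj x y -> y \notin B -> W y.

(** A geodesic towards [y] stays in [W] until it meets [B], and it cannot reach [y] before that. *)
Lemma geodesic_cross x y : W x -> ~ W y ->
  exists2 k, k \in B & dist x y = dist x k + dist k y.
Proof.
move=> + Wy; elim/(@dist_ind y): x => x IH Wx.
have [z xz E] : exists2 z, adj x z & dist x y = dist x z + dist z y.
  by apply: geodesic_step => xy; rewrite -xy in Wy.
have [zB|zB] := boolP (z \in B); first by exists z.
have := dist_gt0 (adj_neq xz) => xz0.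
have [|k kB Ek] := IH z _ (W_adj Wx xz zB); first lra.
exists k => //; move: (dist_triangle x k y) (dist_triangle x z k); lra.
Qed.

(* Summing [mass * laplacian f] over a sublevel set of [f] in [W] leaves the
   flux from [B], which does not depend on the level, and an outward flux, which
   is nonnegative. *)
Lemma finite_laplacian_le (f : G -> R) (m0 : R) :
  0 < m0 -> (forall x, m0 <= mass x) ->
  (forall t, finite_set [set x | W x /\ f x <= t]) ->
  (forall x, W x -> laplacian f x <= 0) ->
  forall e, 0 < e -> finite_set [set x | W x /\ laplacian f x <= - e].
Proof.
move=> m0_gt0 m0_le sublevel super e e0.
pose NB := undup (flatten [seq nbrs k | k <- B]).
(* The absolute value makes [b] nonnegative, so its sum over any part of [NB] is at most [C]. *)
pose b x := \sum_(k <- undup B) weight x k * `|f k - f x|.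
have b0 x : 0 <= b x.
  by apply: sumr_ge0 => k _; rewrite mulr_ge0 ?weight_ge0.
have bN x : x \notin NB -> b x = 0.
  move=> xN; rewrite /b big_seq big1// => k; rewrite mem_undup => kB.
  rewrite weight_adj0 ?mul0r//; apply: contra xN => xk.
  rewrite mem_undup; apply/flattenP; exists (nbrs k); first exact: map_f.
  by rewrite mem_nbrs adj_sym.
pose C := \sum_(x <- NB) b x.
have flux s : uniq s -> {subset s <= W} ->
    \sum_(x <- s) mass x * - laplacian f x <= C.
  move=> us sW.
  have sfin : {in s, forall x, W x} by move=> x /sW; rewrite inE.
  (* [A] completes [s] to the sublevel set of [f] in [W] at the largest value on [s]. An edge
     leaving [A] therefore enters [B] or goes up. *)
  have [A [uA AE]] : exists A, uniq A /\
      forall x, x \in A <-> W x /\ exists2 k, k \in s & f x <= f k.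
    apply: seq_of_finite_set.
    apply: (@finite_set_cover _ _ s (fun k => [set x | W x /\ f x <= f k])).
      by move=> x [Wx [k ks fk]]; exists k.
    by move=> k _; exact: sublevel.
  have sA : {subset s <= A}.
    by move=> x xs; apply/AE; split; [exact: sfin|exists x].
  have AW x : x \in A -> W x by move=> /AE[].
  have step1 : \sum_(x <- s) mass x * - laplacian f x <=
               \sum_(x <- A) mass x * - laplacian f x.
    rewrite [leRHS](bigID (mem s)) /= -[X in _ <= X + _]big_filter.
    rewrite (perm_big [seq x <- A | x \in s]) /=; last first.
      apply: uniq_perm; rewrite ?filter_uniq// => x.
      by rewrite mem_filter; case: (boolP (x \in s)) => //= /sA ->.
    rewrite lerDl big_seq_cond sumr_ge0// => x /andP[/AW Wx _].
    by rewrite mulr_ge0 ?(ltW (mass_gt0 x))// oppr_ge0 super.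
  apply: le_trans step1 _.
  have inner x : x \in A -> mass x * - laplacian f x <=
      \sum_(y <- A) weight x y * (f x - f y) + b x.
    move=> xA; pose S := undup (nbrs x ++ A ++ B).
    rewrite (@laplacianE f x S) ?undup_uniq//; last first.
      by move=> y yx; rewrite mem_undup mem_cat yx.
    rewrite mulrN mulrA mulfV ?mul1r ?gt_eqF ?mass_gt0// -sumrN.
    rewrite (bigID (mem A)) /= -[X in X + _ <= _]big_filter.
    rewrite (perm_big A) /=; last first.
      apply: uniq_perm; rewrite ?filter_uniq ?undup_uniq// => y.
      rewrite mem_filter mem_undup !mem_cat.
      by case: (y \in A); rewrite //= orbT.
    apply: lerD; first by apply: ler_sum => y _; rewrite -mulrN opprB.
    rewrite (bigID (mem B)) /=.
    have -> : b x = b x + 0 by rewrite addr0.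
    apply: lerD.
      rewrite -big_filter (perm_big (undup B)) /=; last first.
        apply: uniq_perm; rewrite ?filter_uniq ?undup_uniq// => y.
        rewrite mem_filter !mem_undup !mem_cat.
        case: (boolP (y \in B)) => yB; last by rewrite andbF.
        rewrite !orbT !andbT; apply/negP => /AW Wy.
        by have := W_B Wy; rewrite yB.
      apply: ler_sum => y _; rewrite -mulrN ler_wpM2l ?weight_ge0//.
      by rewrite -normrN ler_norm.
    rewrite big_seq_cond; apply: sumr_le0 => y /andP[_ /andP[yA yB]].
    have [xy|/weight_adj0 ->] := boolP (adj x y); last by rewrite mul0r oppr0.
    rewrite -mulrN opprB mulr_ge0_le0 ?weight_ge0// subr_le0 leNgt.
    apply: contra yA => yx; apply/AE; split; first exact: W_adj (AW _ xA) xy yB.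
    have /AE[_ [k ks xk]] := xA.
    by exists k => //; rewrite (le_trans (ltW yx)).
  apply: (@le_trans _ _ (\sum_(x <- A) (\sum_(y <- A) weight x y * (f x - f y) + b x))).
    by rewrite big_seq [leRHS]big_seq; apply: ler_sum.
  rewrite big_split /=.
  (* The flux along edges inside [A] is antisymmetric and cancels. *)
  have -> : \sum_(x <- A) \sum_(y <- A) weight x y * (f x - f y) = 0.
    set S := (LHS); suff : S = - S by lra.
    rewrite [LHS]exchange_big -sumrN; apply: eq_bigr => x _.
    by rewrite -sumrN; apply: eq_bigr => y _; rewrite weight_sym -mulrN opprB.
  rewrite add0r /C (bigID (mem NB)) /= [X in _ + X]big1 ?addr0; last first.
    by move=> x; exact: bN.
  rewrite [leRHS](bigID (mem A)) /= -big_filter -[X in _ <= X + _]big_filter.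
  rewrite (perm_big [seq x <- NB | x \in A]) /=; last first.
    apply: uniq_perm; rewrite ?filter_uniq ?undup_uniq// => x.
    by rewrite !mem_filter andbC.
  by rewrite lerDl sumr_ge0.
apply: contrapT => inf.
(* More than [C / (m0 * e)] points, each contributing at least [m0 * e], would exceed the bound
   [C]. *)
pose n := Num.truncn (C / (m0 * e)).
have [F FW Fn] := infinite_set_fset n.+1 inf.
have := flux _ (finmap.fset_uniq F) _.
have : m0 * e * n.+1%:R <= \sum_(x <- finmap.enum_fset F) mass x * - laplacian f x.
  apply: (@le_trans _ _ (\sum_(x <- finmap.enum_fset F) m0 * e)).
    rewrite big_const_seq count_predT iter_addr_0 -[leRHS]mulr_natr.
    by rewrite ler_pM2l ?mulr_gt0// ler_nat.
  rewrite big_seq [leRHS]big_seq; apply: ler_sum => x xF.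
  have [Wx xe] := FW _ xF.
  by rewrite ler_pM ?(ltW m0_gt0) ?(ltW e0)// lerNr.
move=> /le_trans le1 /(_ _)/le1 le2.
have : m0 * e * n.+1%:R <= C by apply: le2 => x /FW[Wx _]; rewrite inE.
rewrite mulrC -ler_pdivlMr ?mulr_gt0// leNgt => /negP; apply.
by rewrite truncnS_gt.
Qed.

End Separation.

(** * Curvature and the decrease of the Laplacian along gradients *)

Section Curvature.
Hypothesis curv_ge0 : nonneg_ollivier_curvature G.

Lemma laplacian_gradient_adj f x y : adj x y -> Lip1 f -> f y - f x = dist x y ->
  laplacian f y <= laplacian f x.
Proof.
move=> xy fL fxy; have := curv_ge0 xy; rewrite /ollivier_curvature.
rewrite pmule_rge0 ?lte_fin ?invr_gt0 ?dist_gt0//; last exact: adj_neq.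
by move=> /ereal_infP/(_ (laplacian f x - laplacian f y)%:E);
  rewrite lee_fin subr_ge0; apply; exists f.
Qed.

(** Along a geodesic from [x] to [y] the function rises at unit rate, so the estimate for edges
    chains. *)
Lemma laplacian_gradient f x y : Lip1 f -> f y - f x = dist x y ->
  laplacian f y <= laplacian f x.
Proof.
move=> fL; elim/(@dist_ind y): x => x IH fxy.
have [->//|/eqP xny] := eqVneq x y.
have [z xz E] := geodesic_step xny.
have [fxz fzy] := Lip1_geodesic fL E fxy.
apply: le_trans (laplacian_gradient_adj xz fL fxz).
by apply: IH => //; rewrite E ltrDr dist_gt0//; exact: adj_neq.
Qed.

(* Otherwise the least Lipschitz function with the values of [f] near [y] would
   be smaller than [f] at [x'], hence violate [laplacian_gradient]. *)
Lemma gradient_nbr f x y x' : Lip1 f -> f y - f x = dist x y ->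
  laplacian f x <= laplacian f y -> adj x x' ->
  exists2 y', y' \in y :: nbrs y & f y' - f x' = dist x' y'.
Proof.
move=> fL fxy lap_xy xx'; apply: contrapT => nex.
pose h := lower_ext y (y :: nbrs y) f.
have ys : y \in y :: nbrs y by rewrite mem_head.
have hf z : h z <= f z by exact: lower_ext_le.
have hfy z : z \in y :: nbrs y -> h z = f z.
  by apply: lower_ext_id => // u v _ _; exact: fL.
have hx : h x = f x.
  by apply/le_anti; rewrite hf /=; have := lower_ext_ge y f x ys; rewrite -/h; lra.
have hx' : h x' < f x'.
  have [k ks Ek] := lower_ext_attained f x' ys.
  rewrite /h Ek ltNge; apply/negP => le; apply: nex; exists k => //.
  by apply/le_anti; rewrite fL /=; lra.
have hlt : laplacian h x < laplacian f x by exact: (laplacian_lt xx').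
have hy : laplacian h y = laplacian f y.
  rewrite !laplacian_nbrs !big_seq; congr (_ * _); apply: eq_bigr => z zy.
  by rewrite !hfy// inE zy orbT.
have hL : Lip1 h by exact: lower_ext_Lip1.
have := laplacian_gradient hL (x := x) (y := y).
rewrite hx hfy// => /(_ fxy); rewrite hy; lra.
Qed.
End Curvature.

Lemma laplacian_add f c x : laplacian (fun z => f z + c) x = laplacian f x.
Proof.
rewrite !laplacian_nbrs; congr (_ * _); apply: eq_bigr => y _.
by congr (_ * _); lra.
Qed.

(* Raising [F] near [y] by the defect, just enough to realise the gradient
   between [x] and [y], reduces this to [laplacian_gradient]. *)
Lemma laplacian_defect (curv_ge0 : nonneg_ollivier_curvature G) f x y : Lip1 f ->
  laplacian f y - laplacian f x <= (dist x y - (f y - f x)) * (deg x + deg y).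
Proof.
move=> fL; set d := dist x y - _.
have d0 : 0 <= d by rewrite subr_ge0 fL.
pose h z := Num.max (f z) (f y + d - dist z y).
have hx : h x = f x by rewrite /h max_l// /d; lra.
have hy : h y = f y + d by rewrite /h dist_xx max_r; lra.
have fh z : f z <= h z by rewrite /h le_max lexx.
have hf z : h z <= f z + d by rewrite /h ge_max; move: (fL z y); lra.
have hL : Lip1 h.
  move=> u v; rewrite /h; move: (fL u v) (dist_triangle u v y).
  by case: (leP (f v) (f y + d - dist v y));
    case: (leP (f u) (f y + d - dist u y)); lra.
have := laplacian_gradient curv_ge0 (x := x) (y := y) hL.
have -> : h y - h x = dist x y by rewrite hx hy /d; lra.
move=> /(_ erefl) le_h.
have := @laplacian_le h f x d (fun z _ => hf z).
have : laplacian f y <= laplacian h y + deg y * (h y + 0 - f y).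
  by apply: laplacian_le => z _; rewrite addr0.
rewrite hx hy; nra.
Qed.

(** Any point of [D] can descend to [o] inside [D], so [Q] travels from one point down to [o] and
    from there up to every other. *)
Lemma radial_connected (D Q : set G) o :
  (forall x z, D x -> adj x z -> dist z o < dist x o -> D z) ->
  (forall x z, D x -> D z -> adj x z -> Q x -> Q z) ->
  (exists2 x, D x & Q x) -> forall x, D x -> Q x.
Proof.
move=> Dstep Qadj [x0 D0 Q0].
have step x : D x -> x <> o -> exists z, [/\ D z, adj x z & dist z o < dist x o].
  move=> Dx xo; have [z xz E] := geodesic_step xo.
  have zo : dist z o < dist x o by rewrite E ltrDr dist_gt0//; exact: adj_neq.
  by exists z; split => //; exact: Dstep zo.
have [Do Qo] : D o /\ Q o.
  elim/(@dist_ind o): x0 D0 Q0 => x IH Dx Qx.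
  have [<-//|/eqP xo] := eqVneq x o.
  have [z [Dz xz zx]] := step _ Dx xo.
  by apply: (IH z) => //; exact: Qadj xz Qx.
elim/(@dist_ind o) => x IH Dx.
have [->//|/eqP xo] := eqVneq x o.
have [z [Dz xz zx]] := step _ Dx xo.
by apply: (Qadj z) => //; [rewrite adj_sym|exact: IH].
Qed.

Definition Lip1_on s : set (G -> R) :=
  [set f | {in s &, forall u v, f v - f u <= dist u v}].


(** The normalisation [g o = 0] confines a 1-Lipschitz [g] to the box with bounds [dist o]. *)
Lemma Lip1_argmin (o : G) s (F : (G -> R) -> R) (L : R) :
  (forall f g (e : R), 0 < e -> {in s, forall k, `|f k - g k| <= e} ->
     F f <= F g + L * e) ->
  exists2 f, Lip1 f & forall g, Lip1 g -> g o = 0 -> F f <= F g.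
Proof.
move=> /(box_argmin (c := dist o) (D := @dist R G))[|f fL fmin].
  exists (fun _ => 0) => [x|x y]; first by rewrite normr0 dist_ge0.
  by rewrite subrr dist_ge0.
exists f => // g gL go; apply: fmin => // x; rewrite ler_norml.
by move: (gL o x) (gL x o); rewrite go dist_sym => *; apply/andP; split; lra.
Qed.

(** * Extremal extensions from [B] and their largest Laplacian on [B] *)

Section Extension.
Variables (o : G) (B : seq G) (N : set G).
Hypothesis o_B : o \in B.
Hypothesis N_B : forall x, N x -> x \notin B.
Hypothesis N_adj : forall x y, N x -> adj x y -> y \notin B -> N y.

(* The 1-Lipschitz extension of [f] from [B] that is minimal on [N] and maximal
   elsewhere. *)
Definition extremal_ext f : G -> R := fun z =>
  if `[< N z >] then lower_ext o B f z else - lower_ext o B (fun k => - f k) z.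

Lemma extremal_ext_outP f z : ~ N z ->
  (forall k, k \in B -> extremal_ext f z <= f k + dist z k) /\
  exists2 k, k \in B & extremal_ext f z = f k + dist z k.
Proof.
move=> Nz; rewrite /extremal_ext asboolF//; split=> [k kB|].
  by move: (lower_ext_ge o (fun k => - f k) z kB); lra.
have [k kB ->] := lower_ext_attained (fun k => - f k) z o_B.
by exists k => //; lra.
Qed.

Lemma extremal_ext_inP f z : N z ->
  (forall k, k \in B -> f k - dist z k <= extremal_ext f z) /\
  exists2 k, k \in B & extremal_ext f z = f k - dist z k.
Proof.
move=> Nz; rewrite /extremal_ext asboolT//; split=> [k kB|].
  exact: lower_ext_ge.
exact: lower_ext_attained.
Qed.

Lemma extremal_ext_id f k : Lip1_on B f -> k \in B -> extremal_ext f k = f k.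
Proof.
move=> fL kB; have Nk : ~ N k by move=> /N_B; rewrite kB.
have [le [v vB Ev]] := extremal_ext_outP f Nk.
move: (le _ kB) (fL _ _ vB kB); rewrite dist_xx Ev dist_sym => *.
by apply/le_anti/andP; split; lra.
Qed.

Lemma extremal_ext_mono f g e z : {in B, forall k, f k <= g k + e} ->
  extremal_ext f z <= extremal_ext g z + e.
Proof.
move=> fg; have [Nz|Nz] := pselect (N z).
  have [_ [k kB ->]] := extremal_ext_inP f Nz.
  have [/(_ _ kB) + _] := extremal_ext_inP g Nz.
  by move: (fg _ kB); lra.
have [_ [k kB ->]] := extremal_ext_outP g Nz.
have [/(_ _ kB) + _] := extremal_ext_outP f Nz.
by move: (fg _ kB); lra.
Qed.

(** A geodesic from [N] to its complement crosses [B], where the two formulas are compared. In the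
    opposite direction the Lipschitz bound on [B] and the triangle inequality suffice. *)
Lemma extremal_ext_Lip1 f : Lip1_on B f -> Lip1 (extremal_ext f).
Proof.
move=> fL x y.
have [Nx|Nx] := pselect (N x); have [Ny|Ny] := pselect (N y).
- have := @lower_ext_Lip1 _ _ f o_B x y.
  by rewrite /extremal_ext !asboolT.
- have [/= lex _] := extremal_ext_inP f Nx.
  have [ley _] := extremal_ext_outP f Ny.
  have [k kB ->] := geodesic_cross N_adj Nx Ny.
  by move: (lex _ kB) (ley _ kB); rewrite (dist_sym y k); lra.
- have [_ [k kB ->]] := extremal_ext_outP f Nx.
  have [_ [v vB ->]] := extremal_ext_inP f Ny.
  move: (fL _ _ kB vB) (dist_ge0 x k) (dist_ge0 y v).
  move: (dist_triangle k x v) (dist_triangle x y v).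
  by rewrite (dist_sym k x); lra.
- have := Lip1N (@lower_ext_Lip1 _ _ (fun k => - f k) o_B) x y.
  by rewrite /extremal_ext !asboolF.
Qed.

Lemma Lip1_on_Lip1 f : Lip1 f -> Lip1_on B f.
Proof. by move=> fL u v _ _; exact: fL. Qed.

Definition ext_lap f x : R := laplacian (extremal_ext f) x.

Definition ext_lap_max f : R := seqmax o B (ext_lap f).

Lemma ext_lap_le_max f k : k \in B -> ext_lap f k <= ext_lap_max f.
Proof. exact: seqmax_ge. Qed.

Lemma ext_lap_max_le f M :
  {in B, forall k, ext_lap f k <= M} -> ext_lap_max f <= M.
Proof.
by move=> le; have [k kB] := seqmax_attained (ext_lap f) o_B;
  rewrite -/(ext_lap_max f) => ->; exact: le.
Qed.

Lemma deg_le_sum x : x \in B -> deg x <= \sum_(k <- B) deg k.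
Proof.
move=> xB; rewrite (big_rem x xB)/= lerDl sumr_ge0// => k _; exact: deg_ge0.
Qed.

(** An error of [e] on [B] stays at most [e] everywhere, which raises the Laplacian at [x] by at
    most [2 * deg x * e]. *)
Lemma ext_lap_max_continuous f g e : 0 < e ->
  {in B, forall k, `|f k - g k| <= e} ->
  ext_lap_max f <= ext_lap_max g + 2 * (\sum_(k <- B) deg k) * e.
Proof.
move=> e0 fg; apply: ext_lap_max_le => x xB.
have fg1 z : extremal_ext f z <= extremal_ext g z + e.
  by apply: extremal_ext_mono => k /fg; rewrite ler_norml => /andP[_]; lra.
have gf1 z : extremal_ext g z <= extremal_ext f z + e.
  by apply: extremal_ext_mono => k /fg; rewrite ler_norml => /andP[+ _]; lra.
have := @laplacian_le _ _ x _ (fun z _ => fg1 z).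
rewrite -!/(ext_lap _ x) => le1.
apply: le_trans le1 _; apply: lerD; first exact: ext_lap_le_max.
rewrite -mulrA mulrCA; apply: ler_pM; rewrite ?deg_ge0 ?deg_le_sum//.
- by move: (fg1 x); lra.
- by move: (gf1 x); lra.
Qed.

(** Extending [g] and subtracting its value at [o] leaves the Laplacian of the extension unchanged,
    so a minimum over normalised functions is one over all. *)
Lemma ext_lap_max_argmin : exists2 f, Lip1_on B f &
  forall g, Lip1_on B g -> ext_lap_max f <= ext_lap_max g.
Proof.
have [f fL fmin] := Lip1_argmin o ext_lap_max_continuous.
exists f => [|g gL]; first exact: Lip1_on_Lip1.
pose c := extremal_ext g o; pose h z := extremal_ext g z + (- c).
have hL : Lip1 h.
  by move=> x y; have := extremal_ext_Lip1 gL x y; rewrite /h; lra.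
have hB k : k \in B -> h k = g k - c by move=> kB; rewrite /h extremal_ext_id.
have hE : extremal_ext h = fun z => extremal_ext g z + (- c).
  apply/funext => z; apply/le_anti/andP; split.
    by apply: extremal_ext_mono => k /hB ->.
  suff : extremal_ext g z <= extremal_ext h z + c by lra.
  by apply: extremal_ext_mono => k /hB ->; lra.
have -> : ext_lap_max g = ext_lap_max h.
  rewrite /ext_lap_max; congr seqmax; apply/funext => x.
  by rewrite /ext_lap hE laplacian_add.
by apply: fmin => //; rewrite /h /c subrr.
Qed.

(** * An explicit Euler step of the heat flow on [B] *)

Section HeatStep.
Hypothesis curv_ge0 : nonneg_ollivier_curvature G.

(** The factor 2 covers the two degrees that occur in [laplacian_defect]. *)
Let eps : R := (1 + 2 * \sum_(k <- B) deg k)^-1.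

Let eps_gt0 : 0 < eps.
Proof.
by rewrite invr_gt0 ltr_pwDl// mulr_ge0// sumr_ge0// => k _; exact: deg_ge0.
Qed.

Let eps_deg x : x \in B -> 2 * (eps * deg x) < 1.
Proof.
move=> /deg_le_sum le; have : 0 < 1 + 2 * \sum_(k <- B) deg k.
  by rewrite -invr_gt0.
by move=> D0; rewrite /eps mulrCA mulrC ltr_pdivrMr//; lra.
Qed.

Definition heat_step f x : R := f x + eps * ext_lap f x.

(** By [laplacian_defect] the Laplacian rises from [x] to [y] at most in proportion to the defect
    [d], and [eps] is so small that the step uses up no more than [d]. *)
Lemma heat_step_Lip f : Lip1_on B f -> Lip1_on B (heat_step f).
Proof.
move=> fL x y xB yB; rewrite /heat_step.
have := laplacian_defect curv_ge0 x y (extremal_ext_Lip1 fL).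
rewrite -!/(ext_lap f _) !extremal_ext_id//.
have := fL _ _ xB yB; have := eps_deg xB; have := eps_deg yB.
set d := dist x y - _ => ey ex d0 lap.
have {}d0 : 0 <= d by rewrite /d subr_ge0.
have : eps * (ext_lap f y - ext_lap f x) <= eps * (d * (deg x + deg y)).
  by rewrite ler_pM2l.
have : d * (eps * deg x + eps * deg y) <= d * 1.
  by rewrite ler_wpM2l//; lra.
rewrite /d; lra.
Qed.

(** The new Laplacian is at most a convex combination of [ext_lap f x] and [M], with weight
    [eps * deg x] below 1 on [M]. Equality thus forces the value [M] at [x], and strict comparison
    then forces it at the neighbours in [B]. *)
Lemma heat_step_lap f M x : Lip1_on B f ->
  {in B, forall k, ext_lap f k <= M} -> x \in B ->
  ext_lap (heat_step f) x <= M /\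
  (ext_lap (heat_step f) x = M -> ext_lap f x = M /\
    forall z, z \in B -> adj x z -> ext_lap f z = M).
Proof.
move=> fL fM xB; set g := heat_step f.
have gL : Lip1_on B g by exact: heat_step_Lip.
have gf z : extremal_ext g z <= extremal_ext f z + eps * M.
  by apply: extremal_ext_mono => k kB; rewrite lerD2l ler_pM2l// fM.
have := @laplacian_le _ _ x _ (fun z _ => gf z).
rewrite -!/(ext_lap _ x) !extremal_ext_id// => le.
have ex := eps_deg xB; have fxM := fM _ xB.
have e0 : 0 <= eps * deg x by rewrite mulr_ge0 ?deg_ge0// ltW.
have {}le : ext_lap g x <= ext_lap f x + eps * deg x * (M - ext_lap f x).
  suff -> : eps * deg x * (M - ext_lap f x) = deg x * (f x + eps * M - g x) by [].
  by rewrite /g /heat_step; ring.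
split; first nra.
move=> gM; have Ex : ext_lap f x = M.
  apply/le_anti; rewrite fxM leNgt; apply/negP => lt; nra.
split=> // z zB xz; apply/le_anti; rewrite fM//= leNgt; apply/negP => lt.
have := @laplacian_lt (extremal_ext g) (fun u => extremal_ext f u + eps * M) x z xz.
rewrite laplacian_add -!/(ext_lap _ x) gM Ex ltxx !extremal_ext_id// /g /heat_step Ex.
by rewrite ltrD2l ltr_pM2l// => /(_ lt erefl (fun y _ => gf y)).
Qed.

(* The heat step maps a minimiser of [ext_lap_max] to a minimiser whose contact
   set, where the maximum is attained, loses every point with a neighbour outside
   it. As [B] is connected, iterating either empties the contact set, which is
   absurd, or shows that it is all of [B]. *)
Lemma exists_superharmonic :
  (forall Q : set G, (forall x z, x \in B -> z \in B -> adj x z -> Q x -> Q z) ->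
     (exists2 x, x \in B & Q x) -> forall x, x \in B -> Q x) ->
  (forall f (c : R), Lip1_on B f -> 0 < c -> ~ {in B, forall k, c <= ext_lap f k}) ->
  exists2 f, Lip1_on B f & {in B, forall k, ext_lap f k <= 0}.
Proof.
move=> conn noSub; have [f0 f0L f0min] := ext_lap_max_argmin.
set M := ext_lap_max f0 in f0min.
have [M0|M0] := leP M 0.
  by exists f0 => // k kB; apply: le_trans M0; exact: ext_lap_le_max.
exfalso.
suff noMin (n : nat) f : Lip1_on B f -> ext_lap_max f = M ->
    (count (fun x => M <= ext_lap f x)%R B < n)%N -> False.
  exact: (noMin _ f0 f0L erefl (ltnSn _)).
elim: n f => // n IH f fL fM cn.
have fB : {in B, forall k, ext_lap f k <= M}.
  by move=> k kB; rewrite -fM ext_lap_le_max.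
have step x (xB : x \in B) := heat_step_lap fL fB xB.
have gL := heat_step_Lip fL.
have gM : ext_lap_max (heat_step f) = M.
  apply/le_anti; rewrite f0min// andbT; apply: ext_lap_max_le => k kB.
  by have [] := step k kB.
have sub x : x \in B -> M <= ext_lap (heat_step f) x -> M <= ext_lap f x /\
    forall z, z \in B -> adj x z -> M <= ext_lap f z.
  move=> xB Mx; have [le /(_ _)[|-> H]] := step x xB.
    by apply/le_anti; rewrite le Mx.
  by split=> // z zB xz; rewrite H.
have [contact|] := pselect (forall x, x \in B -> M <= ext_lap f x ->
    M <= ext_lap (heat_step f) x).
  apply: (noSub f M fL M0); apply: conn => [x z xB zB xz Mx|].
    by have [_] := sub x xB (contact _ xB Mx); apply.
  have [k kB Ek] := seqmax_attained (ext_lap f) o_B.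
  by exists k; rewrite // -fM /ext_lap_max Ek.
move=> /existsNP[x /not_implyP[xB /not_implyP[Mf /negP Mg]]].
apply: (IH _ gL gM); rewrite -ltnS; apply: leq_ltn_trans cn.
apply: count_lt => [z zB /(sub _ zB)[]//|].
by exists x => //; rewrite Mf.
Qed.

End HeatStep.
End Extension.

(** * Points with infinitely many gradient targets in [X] *)

Section GradientTargets.
Hypothesis curv_ge0 : nonneg_ollivier_curvature G.
Variables (B : seq G) (X : set G) (f : G -> R).
Hypothesis X_adj : forall x y, X x -> adj x y -> y \notin B -> X y.
Hypothesis f_Lip : Lip1 f.

Definition targets x : set G := [set y | X y /\ f y - f x = dist x y].

(** A König-type argument: among the points of a ball reached by a gradient from [x] and having
    infinitely many targets, one with maximal [f] must continue to a neighbour outside the ball. *)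
Lemma infinite_targets_far x s : infinite_set (targets x) ->
  exists z, [/\ X z, f z - f x = dist x z, infinite_set (targets z) & z \notin s].
Proof.
move=> Tx.
pose r1 := seqmax x (x :: s ++ B) (dist x).
(* Beyond radius [r], a point reached by a gradient from [x] has a larger value of [f] than all of
   [B]. *)
pose r := Num.max r1 (seqmax x B f - f x).
have r_xs u : u \in x :: s ++ B -> dist x u <= r.
  by move=> us; rewrite /r le_max seqmax_ge.
have r_s u : u \in s ++ B -> dist x u <= r.
  by move=> us; apply: r_xs; rewrite inE us orbT.
have r_B k : k \in B -> f k <= f x + r.
  by move=> kB; rewrite -lerBlDl /r le_max orbC lerB// seqmax_ge.
pose S := [seq y <- ball_seq x r |
  `[< f y - f x = dist x y /\ infinite_set (targets y) >]].
have xS : x \in S.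
  rewrite mem_filter mem_ball_seq r_xs ?mem_head// andbT.
  by apply/asboolP; rewrite subrr dist_xx.
have [y yS ymax] := seqmax_attained f xS.
move: yS; rewrite mem_filter mem_ball_seq => /andP[/asboolP[fxy Ty] _].
(* Pigeonhole: geodesics from [y] to its targets begin with finitely many neighbours, one of which
   must have infinitely many targets. *)
have [z [yz fyz Tz]] : exists z,
    [/\ adj y z, f z - f y = dist y z & infinite_set (targets z)].
  apply: contrapT => nex; apply: Ty.
  apply: (@finite_set_cover _ _ (y :: nbrs y) (fun k =>
      [set u | u = k \/ [/\ adj y k, f k - f y = dist y k & targets k u]])).
    move=> u [Xu fu]; have [->|/eqP uy] := eqVneq u y.
      by exists y; [rewrite mem_head|left].
    have [z yz E] := geodesic_step (nesym uy).
    have [fyz fzu] := Lip1_geodesic f_Lip E fu.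
    by exists z; [rewrite inE mem_nbrs yz orbT|right].
  move=> k _; apply: (@sub_finite_set _ _ ([set k] `|`
      [set u | [/\ adj y k, f k - f y = dist y k & targets k u]])).
    by move=> u [->|]; [left|right].
  rewrite finite_setU; split; first exact: finite_set1.
  have [[yk fyk]|nyk] := pselect (adj y k /\ f k - f y = dist y k).
    apply: (@sub_finite_set _ _ (targets k)); first by move=> u [].
    by apply: contrapT => Tk; apply: nex; exists k.
  apply: (@sub_finite_set _ _ set0); last exact: finite_set0.
  by move=> u [yk fyk _]; apply: nyk.
have fxz : f z - f x = dist x z.
  by apply/le_anti; rewrite f_Lip/=; move: (dist_triangle x y z); lra.
have z_r : r < dist x z.
  rewrite ltNge; apply/negP => zr.
  have zS : z \in S.
    by rewrite mem_filter mem_ball_seq zr andbT; apply/asboolP.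
  have := @seqmax_ge _ _ x _ f _ zS; rewrite ymax.
  move: (dist_gt0 (adj_neq yz)); lra.
have zN u : u \in s ++ B -> z != u.
  by move=> us; apply/eqP => E; have := r_s _ us; rewrite -E leNgt z_r.
exists z; split=> //; last first.
  by apply/negP => zs; have := zN z; rewrite mem_cat zs eqxx => /(_ isT).
(* Otherwise a geodesic from [z] to a target [u] would meet [B] at a value at least [f z], too high
   for [B]. *)
apply: contrapT => nXz.
have [u [Xu fzu] _] := infinite_set_big [::] Tz.
have [k kB E] := geodesic_cross X_adj Xu nXz.
have [fzk _] : f k - f z = dist z k /\ f u - f k = dist k u.
  by apply: Lip1_geodesic => //; rewrite dist_sym E addrC (dist_sym k) (dist_sym k).
by move: (r_B _ kB) (dist_ge0 z k); lra.
Qed.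

(** If [t] listed all targets of [x'], a target [z] of [x] far from [B] and [t] with infinitely many
    targets would satisfy the hypothesis of [gradient_nbr]. This yields a target of [x'] near [z],
    hence in [X] and outside [t]. *)
Lemma infinite_targets_adj x x' :
  (forall y, infinite_set (targets y) -> 0 <= laplacian f y) ->
  laplacian f x <= 0 -> adj x x' ->
  infinite_set (targets x) -> infinite_set (targets x').
Proof.
move=> lap_ge0 lapx xx' Tx /seq_of_finite_set[t [_ tE]].
pose nb s := s ++ flatten [seq nbrs k | k <- s].
have nbP s z y : z \notin nb s -> y \in z :: nbrs z -> y \notin s.
  rewrite mem_cat negb_or => /andP[zs zn]; rewrite inE => /orP[/eqP->//|].
  rewrite mem_nbrs => zy; apply: contra zn => ys.
  apply/flattenP; exists (nbrs y); first exact: map_f.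
  by rewrite mem_nbrs adj_sym.
have [z [Xz fxz Tz]] := infinite_targets_far (nb B ++ nb t) Tx.
rewrite mem_cat negb_or => /andP[zB zt].
have [y yz fy] := gradient_nbr curv_ge0 f_Lip fxz
  (le_trans lapx (lap_ge0 _ Tz)) xx'.
have Xy : X y.
  move: (nbP _ _ _ zB yz) (yz); rewrite inE => yB /orP[/eqP->//|].
  by rewrite mem_nbrs => zy; exact: X_adj zy yB.
by have := nbP _ _ _ zt yz; rewrite (_ : y \in t)//; apply/tE.
Qed.

End GradientTargets.

(** * Excluding three ends off a ball *)

Lemma no_three_ends_off_ball (curv_ge0 : nonneg_ollivier_curvature G) (m0 r : R)
    (o : G) (W : 'I_3 -> set G) :
  0 < m0 -> (forall x, m0 <= mass x) -> 0 <= r ->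
  (forall i, infinite_set (W i)) -> (forall i x, W i x -> r < dist o x) ->
  (forall i x y, W i x -> adj x y -> r < dist o y -> W i y) ->
  (forall i j x, W i x -> W j x -> i = j) -> False.
Proof.
move=> m0_gt0 m0_le r0 Winf WB Wadj Wdisj; set B := ball_seq o r.
pose X := W (inord 0); pose Y := W (inord 1); pose Z := W (inord 2).
have XY x : X x -> ~ Y x.
  by move=> Xx Yx; have /(congr1 val) := Wdisj _ _ _ Xx Yx; rewrite /= !inordK.
have ZY x : Z x -> ~ Y x.
  by move=> Zx Yx; have /(congr1 val) := Wdisj _ _ _ Zx Yx; rewrite /= !inordK.
have XZ x : X x -> ~ Z x.
  by move=> Xx Zx; have /(congr1 val) := Wdisj _ _ _ Xx Zx; rewrite /= !inordK.
have BN x : (x \notin B) = (r < dist o x) by rewrite mem_ball_seq -ltNge.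
have o_B : o \in B by rewrite mem_ball_seq dist_xx.
have W_B i x : W i x -> x \notin B by rewrite BN; exact: WB.
have W_adj i x y : W i x -> adj x y -> y \notin B -> W i y.
  by rewrite BN; exact: Wadj.
have X_adj := W_adj (inord 0) : forall x y, X x -> _.
have [Y_B Y_adj] := (W_B (inord 1) : forall x, Y x -> _,
  W_adj (inord 1) : forall x y, Y x -> _).
have sublevel f t : finite_set [set x | ~ Y x /\ extremal_ext o B Y f x <= t].
  apply: (@finite_set_cover _ _ B (fun k => [set x | dist k x <= t - f k])).
    move=> x [Yx xt]; have [_ [k kB Ek]] := extremal_ext_outP o_B f Yx.
    by exists k => //=; move: xt; rewrite Ek dist_sym; lra.
  by move=> k _; exact: finite_balls.
have superlevel f t : finite_set [set x | Y x /\ - extremal_ext o B Y f x <= t].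
  apply: (@finite_set_cover _ _ B (fun k => [set x | dist k x <= t + f k])).
    move=> x [Yx xt]; have [_ [k kB Ek]] := extremal_ext_inP o_B f Yx.
    by exists k => //=; move: xt; rewrite Ek dist_sym; lra.
  by move=> k _; exact: finite_balls.
have [f0 f0L f0B] : exists2 f, Lip1_on B f &
    {in B, forall k, ext_lap o B Y f k <= 0}.
  apply: exists_superharmonic => // [Q Qadj Q0|f c fL c0 fc].
    apply: (@radial_connected [set x | x \in B] Q o) => // x z /=.
    by rewrite !mem_ball_seq !(dist_sym o) => xr _ zx; rewrite (le_trans (ltW zx)).
  pose F := extremal_ext o B Y f.
  have FL : Lip1 F by exact: extremal_ext_Lip1.
  (* On [Y] the gradient of [F] runs from [x] up to a point of [B], which carries the lower bound
     [c] from [B] to [Y]. *)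
  have Flap x : Y x -> laplacian (fun z => - F z) x <= - c.
    move=> Yx; have [_ [k kB Ek]] := extremal_ext_inP o_B f Yx.
    rewrite laplacianN lerN2; apply: le_trans (fc k kB) _.
    apply: (laplacian_gradient curv_ge0) => //.
    by rewrite /F Ek extremal_ext_id// opprB addrC subrK.
  apply: (Winf (inord 1)); apply: sub_finite_set
    (finite_laplacian_le (W := Y) (f := fun z => - F z)
    Y_B Y_adj m0_gt0 m0_le (superlevel f) _ c0) => [x Yx|x Yx].
    by split => //; exact: Flap.
  by apply: le_trans (Flap _ Yx) _; rewrite oppr_le0 ltW.
pose f := extremal_ext o B Y f0.
have fL : Lip1 f by exact: extremal_ext_Lip1.
have f_grad x : ~ Y x -> exists2 k, k \in B & f x - f k = dist k x.
  move=> Yx; have [_ [k kB Ek]] := extremal_ext_outP o_B f0 Yx.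
  by exists k; rewrite // /f Ek extremal_ext_id// addrAC subrr add0r dist_sym.
have f_super x : ~ Y x -> laplacian f x <= 0.
  move=> /f_grad[k kB fk]; apply: le_trans (f0B k kB).
  exact: laplacian_gradient fk.
have f_small e : 0 < e -> finite_set [set x | X x /\ laplacian f x <= - e].
  move=> e0; apply: (finite_laplacian_le (W_B (inord 0)) X_adj m0_gt0 m0_le _ _ e0).
  - move=> t; apply: sub_finite_set (sublevel f0 t) => x [Xx xt].
    by split => //; exact: XY.
  - by move=> x Xx; apply: f_super; exact: XY.
(* A negative Laplacian at [x] would pass to all targets of [x], but [f_small] allows only finitely
   many such points. *)
have T_lap x : infinite_set (targets X f x) -> 0 <= laplacian f x.
  move=> Tx; rewrite leNgt; apply/negP => lt; apply: Tx.
  have e0 : 0 < - laplacian f x by rewrite oppr_gt0.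
  apply: sub_finite_set (f_small _ e0) => y [Xy fxy]; split => //.
  by rewrite opprK; exact: laplacian_gradient fxy.
(* The targets of the finitely many points of [B] cover the infinite set [X]. *)
have T0 : exists2 x, ~ Y x & infinite_set (targets X f x).
  apply: contrapT => nex; apply: (Winf (inord 0)).
  apply: (@finite_set_cover _ _ B (targets X f)) => [x Xx|k kB].
    have [|k kB fk] := f_grad x; first exact: XY.
    by exists k.
  by apply: contrapT => Tk; apply: nex; exists k => // /Y_B; rewrite kB.
(* A step towards [o] from outside [Y] cannot enter [Y]: the starting point would lie off the ball
   and next to [Y], hence in [Y]. *)
have T_all : forall x, ~ Y x -> infinite_set (targets X f x).
  apply: (@radial_connected [set x | ~ Y x]
    [set x | infinite_set (targets X f x)] o) => // x z /=.
    move=> Yx xz zx Yz; apply: Yx; apply: (Y_adj z) => //; first by rewrite adj_sym.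
    by rewrite BN dist_sym (lt_trans _ zx)// dist_sym (WB (inord 1)).
  by move=> Yx _ xz; apply: (infinite_targets_adj curv_ge0 X_adj fL T_lap _ xz) => //;
    exact: f_super.
apply: (Winf (inord 2)); apply: sub_finite_set (sublevel f0 (seqmax o B f)) => z Zz.
have Yz := ZY z Zz.
split => //; have [y [Xy fzy] _] := infinite_set_big [::] (T_all _ Yz).
have [|k kB E] := geodesic_cross (W_adj (inord 2)) Zz (y := y); first exact: XZ.
have [fzk _] := Lip1_geodesic fL E fzy.
apply: le_trans (seqmax_ge o f kB).
by move: (dist_ge0 z k); rewrite -/f; lra.
Qed.

(** * Connected components, and passage from a finite set to a ball *)

Lemma component_of_adj (S : set G) x y z :
  component_of S x y -> adj y z -> S z -> component_of S x z.
Proof.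
move=> [p [px py pS]] yz Sz; exists (rcons p z); split.
- by rewrite rcons_path px py.
- by rewrite last_rcons.
- by move=> u; rewrite -rcons_cons mem_rcons inE => /orP[/eqP->//|/pS].
Qed.

Lemma component_of_refl (S : set G) x : S x -> component_of S x x.
Proof. by move=> Sx; exists [::]; split=> // z; rewrite inE => /eqP->. Qed.

Lemma component_of_sym (S : set G) x y :
  component_of S x y -> component_of S y x.
Proof.
move=> [p]; elim: p x => [|z p IH] x [/= px py pS].
  by rewrite py; apply: component_of_refl; rewrite -py; apply: pS; exact: mem_head.
have /andP[xz zp] := px.
apply: (@component_of_adj _ _ z); last by apply: pS; exact: mem_head.
  by apply: IH; split=> // u uz; apply: pS; rewrite inE uz orbT.
by rewrite adj_sym.
Qed.

Lemma component_of_trans (S : set G) x y z :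
  component_of S x y -> component_of S y z -> component_of S x z.
Proof.
move=> xy [p]; elim: p y xy => [|u p IH] y xy [/= py pz pS]; first by rewrite -pz.
have /andP[yu up] := py.
apply: (IH u); last by split=> // v vu; apply: pS; rewrite inE vu orbT.
by apply: component_of_adj xy yu _; apply: pS; rewrite !inE eqxx orbT.
Qed.

Lemma component_of_meet (S : set G) x y z :
  component_of S x z -> component_of S y z -> component_of S x = component_of S y.
Proof.
move=> xz yz; apply/seteqP; split=> u; apply: component_of_trans.
  by apply: component_of_trans yz _; exact: component_of_sym.
by apply: component_of_trans xz _; exact: component_of_sym.
Qed.

End MetricGraphTheory.

Theorem corollary1p2 (R : realType) (G : metric_graph R)
    (curv_ge0 : nonneg_ollivier_curvature G)
    (mass_inf_gt0 : (0 < ereal_inf [set (mass x)%:E | x in [set: G]])%E) :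
  ~ has_at_least_ends G 3.
Proof.
move=> [K /seq_of_finite_set[s [_ sE]] [C [Cinj Ccomp]]].
have [_ C0inf] := Ccomp ord0; have [ o _ _] := infinite_set_big [::] C0inf.
(* The infimum is finite because [o] is a vertex, so it serves as [m0]. *)
have [m0 m0_gt0 m0_le] : exists2 m0 : R, 0 < m0 & forall x : G, m0 <= mass x.
  have inf_le (x : G) : (ereal_inf [set (mass x)%:E | x in [set: G]] <= (mass x)%:E)%E.
    by apply: ge_ereal_inf; exists (mass x)%:E => //; exists x.
  case: (ereal_inf _) mass_inf_gt0 inf_le => [m| |] // m_gt0 inf_le.
    by exists m => // x; have := inf_le x; rewrite lee_fin.
  by have := inf_le o; rewrite leye_eq.
(* The ball of radius [r] contains [K]. Cutting this finite ball out of the components leaves them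
   infinite. *)
pose r := seqmax o (o :: s) (dist o).
have r_ge0 : 0 <= r by rewrite -(dist_xx o) seqmax_ge// mem_head.
have K_r (x : G) : r < dist o x -> ~ K x.
  by move=> xr /sE xs; move: xr; rewrite ltNge seqmax_ge// inE xs orbT.
apply: (no_three_ends_off_ball curv_ge0 (o := o)
  (W := fun i => [set x | C i x /\ r < dist o x]) m0_gt0 m0_le r_ge0).
- move=> i offfin; have [_ Cinf] := Ccomp i; apply: Cinf.
  apply: (@sub_finite_set _ _
      ([set x | C i x /\ r < dist o x] `|` [set x | dist o x <= r])).
    by move=> x Cx; have [xr|xr] := leP (dist o x) r; [right|left].
  by rewrite finite_setU; split => //; exact: finite_balls.
- by move=> i x [].
- move=> i x y [Cx _] xy yr; split => //; have [[z _ Ei] _] := Ccomp i.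
  by move: Cx; rewrite Ei => /component_of_adj; apply => //; exact: K_r.
- move=> i j x [Cix _] [Cjx _]; apply: Cinj.
  have [[y _ Ei] _] := Ccomp i; have [[z _ Ej] _] := Ccomp j; rewrite Ei Ej.
  by apply: (@component_of_meet _ _ _ _ _ x); rewrite -?Ei -?Ej.
Qed.
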